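(* Let $M$ be the round two-dimensional sphere, of constant Gaussian curvature $\kappa>0$, and let $u$ be (at a given time) a solution of the Navier–Stokes system $u_t+\nabla_u u-\mu Lu+\mathsf{grad}(p)=0$, $\mathsf{div}(u)=0$ on $M$. Decompose $u=u^K+u^\perp$, where $u^K$ is Killing and $u^\perp$ is $L^2$-orthogonal to all Killing vector fields, and let $\zeta^K=\mathsf{rot}(u^K)$, $\zeta^\perp=\mathsf{rot}(u^\perp)$, so that the vorticity $\zeta=\mathsf{rot}(u)$ is $\zeta=\zeta^K+\zeta^\perp$. Then \[ \langle \zeta^K,\zeta^\perp\rangle=0 . \]
   Context: All fields are smooth; $\mu$ is a constant; $\nabla$ is the Levi-Civita connection, $\mathsf{grad}(p)=g^{ij}p_{;j}$, $\mathsf{div}(u)=u^i_{;i}$. In $u^k_{;ij}$ the rightmost index is the last covariant derivative taken. $Lu=\mathsf{div}(Su)$ with $(Su)^{kj}=g^{ki}u^j_{;i}+g^{ij}u^k_{;i}$, i.e. $(Lu)^j=g^{ki}u^j_{;ik}+g^{ij}u^k_{;ik}$. A vector field $u$ is Killing if $Su=0$. The sphere is oriented, and in positively oriented coordinates $\varepsilon=\sqrt{\det g}\,(dx_1\otimes dx_2-dx_2\otimes dx_1)$; $(Ku)^k=g^{ki}\varepsilon_{ij}u^j=\varepsilon^k_j u^j$ and $\mathsf{rot}(u)=\mathsf{div}(Ku)=\varepsilon^k_j u^j_{;k}$. The inner products are $\langle f,h\rangle=\int_M fh\,\omega_M$ for functions and $\langle u,v\rangle=\int_M g(u,v)\,\omega_M$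 for vector fields. *)

(* Defs.v *)
From Stdlib Require Import Reals Lra.
From Coquelicot Require Import Coquelicot.
Open Scope R_scope.

(** * Smooth functions on open sets of R^2 and of R x R^2 *)

Definition R2 : NormedModule R_AbsRing :=
  prod_NormedModule R_AbsRing R_NormedModule R_NormedModule.
Definition RxR2 : NormedModule R_AbsRing :=
  prod_NormedModule R_AbsRing R_NormedModule R2.

Definition dirder {V : NormedModule R_AbsRing} (v : V) (f : V -> R) (x : V) : R :=
  Derive (fun s => f (plus x (scal s v))) 0.

(** In finite dimension, class C^n on the open set [D]: the iterated
    directional derivatives up to order n exist and are continuous on [D]. *)
Fixpoint Cn {V : NormedModule R_AbsRing} (n : nat) (D : V -> Prop) (f : V -> R)
    : Prop :=
  (forall x, D x -> continuous f x) /\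
  match n with
  | O => True
  | S n' => forall v : V,
      (forall x, D x -> ex_derive (fun s => f (plus x (scal s v))) 0) /\
      Cn n' D (dirder v f)
  end.

Definition smooth_on {V : NormedModule R_AbsRing} (D : V -> Prop) (f : V -> R)
    : Prop := forall n, Cn n D f.

(** * Riemannian tensor calculus in coordinates, in dimension two *)

Inductive ix : Set := i1 | i2.

Definition sum (F : ix -> R) : R := F i1 + F i2.

Definition basis (i : ix) : R2 := match i with i1 => (1, 0) | i2 => (0, 1) end.

Definition pd (i : ix) (f : R2 -> R) : R2 -> R := dirder (basis i) f.

(** [u k] is the component u^k; [g i j] is g_{ij}. *)
Definition components := ix -> R2 -> R.
Definition components2 := ix -> ix -> R2 -> R.

Section Coordinates.

Variable g : components2.

Definition detg (x : R2) : R := g i1 i1 x * g i2 i2 x - g i1 i2 x * g i2 i1 x.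

Definition ginv (i j : ix) (x : R2) : R :=
  match i, j with
  | i1, i1 => g i2 i2 x / detg x
  | i1, i2 => - g i1 i2 x / detg x
  | i2, i1 => - g i2 i1 x / detg x
  | i2, i2 => g i1 i1 x / detg x
  end.

(** Gamma^k_{ij} of the Levi-Civita connection. *)
Definition christoffel (k i j : ix) (x : R2) : R :=
  / 2 * sum (fun l => ginv k l x *
    (pd i (g l j) x + pd j (g l i) x - pd l (g i j) x)).

(** [cov u k i] is u^k_{;i}. *)
Definition cov (u : components) (k i : ix) (x : R2) : R :=
  pd i (u k) x + sum (fun l => christoffel k i l x * u l x).

(** [cov2 u k i j] is u^k_{;ij}, the covariant derivative in the direction j of
    the tensor u^k_{;i}. *)
Definition cov2 (u : components) (k i j : ix) (x : R2) : R :=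
  pd j (cov u k i) x
  + sum (fun l => christoffel k j l x * cov u l i x)
  - sum (fun l => christoffel l j i x * cov u k l x).

Definition c_div (u : components) (x : R2) : R := sum (fun i => cov u i i x).

Definition c_grad (p : R2 -> R) (i : ix) (x : R2) : R :=
  sum (fun j => ginv i j x * pd j p x).

Definition c_S (u : components) (k j : ix) (x : R2) : R :=
  sum (fun i => ginv k i x * cov u j i x)
  + sum (fun i => ginv i j x * cov u k i x).

Definition c_L (u : components) (j : ix) (x : R2) : R :=
  sum (fun k => sum (fun i => ginv k i x * cov2 u j i k x))
  + sum (fun k => sum (fun i => ginv i j x * cov2 u k i k x)).

(** (nabla_u u)^j *)
Definition c_convection (u : components) (j : ix) (x : R2) : R :=
  sum (fun k => u k x * cov u j k x).

Definition c_eps (i j : ix) (x : R2) : R :=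
  match i, j with
  | i1, i2 => sqrt (detg x)
  | i2, i1 => - sqrt (detg x)
  | _, _ => 0
  end.

Definition c_K (u : components) (k : ix) (x : R2) : R :=
  sum (fun i => sum (fun j => ginv k i x * c_eps i j x * u j x)).

Definition c_rot (u : components) (x : R2) : R := c_div (c_K u) x.

Definition c_dot (u v : components) (x : R2) : R :=
  sum (fun i => sum (fun j => g i j x * u i x * v j x)).

End Coordinates.

(** * The round sphere of curvature kappa, as the sphere of radius
    1 / sqrt kappa in Euclidean space with the induced metric *)

Record R3 : Set := mkR3 { X1 : R; X2 : R; X3 : R }.

Definition dot3 (a b : R3) : R := X1 a * X1 b + X2 a * X2 b + X3 a * X3 b.

Definition add3 (a b : R3) : R3 := mkR3 (X1 a + X1 b) (X2 a + X2 b) (X3 a + X3 b).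

Definition radius (kappa : R) : R := / sqrt kappa.

Definition on_sphere (kappa : R) (X : R3) : Prop := dot3 X X = radius kappa ^ 2.

(** [north] covers all points but the south pole, [south] all but the north
    pole. *)
Inductive chart : Set := north | south.

(** Inverse stereographic projections. The [south] one is the [north] one
    followed by the rotation of angle PI around the first axis, so both are
    positively oriented for the outward normal. *)
Definition param (kappa : R) (c : chart) (x : R2) : R3 :=
  let r := radius kappa in
  let a := fst x in
  let b := snd x in
  let d := 1 + a ^ 2 + b ^ 2 in
  match c with
  | north => mkR3 (r * (2 * a) / d) (r * (2 * b) / d) (r * (2 - d) / d)
  | south => mkR3 (r * (2 * a) / d) (- (r * (2 * b) / d)) (- (r * (2 - d) / d))
  end.

Definition coord (kappa : R) (c : chart) (X : R3) : R2 :=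
  let r := radius kappa in
  match c with
  | north => (X1 X / (r + X3 X), X2 X / (r + X3 X))
  | south => (X1 X / (r - X3 X), - X2 X / (r - X3 X))
  end.

(** The coordinate vector fields, as vectors of the ambient space. *)
Definition dparam (kappa : R) (c : chart) (i : ix) (x : R2) : R3 :=
  mkR3 (pd i (fun y => X1 (param kappa c y)) x)
       (pd i (fun y => X2 (param kappa c y)) x)
       (pd i (fun y => X3 (param kappa c y)) x).

Definition metric (kappa : R) (c : chart) : components2 :=
  fun i j x => dot3 (dparam kappa c i x) (dparam kappa c j x).

(** Functions and vector fields on the sphere are represented by maps defined
    on the ambient space, of which only the values on the sphere are used. *)
Definition sfun := R3 -> R.
Definition sfield := R3 -> R3.

(** The components u^i, characterized by u = u^i d_i for tangent u. *)
Definition comp (kappa : R) (c : chart) (u : sfield) : components :=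
  fun i x => sum (fun j => ginv (metric kappa c) i j x *
                           dot3 (u (param kappa c x)) (dparam kappa c j x)).

Definition tangent (kappa : R) (u : sfield) : Prop :=
  forall X, on_sphere kappa X -> dot3 (u X) X = 0.

Definition vector_field (kappa : R) (u : sfield) : Prop :=
  tangent kappa u /\
  forall c i, smooth_on (fun _ => True) (comp kappa c u i).

(** Smoothness is joint in time and space, for times in the open set [I]. *)
Definition time_vector_field (kappa : R) (I : R -> Prop) (u : R -> sfield)
    : Prop :=
  (forall t, I t -> tangent kappa (u t)) /\
  forall c i, smooth_on (V := RxR2) (fun q => I (fst q))
                (fun q => comp kappa c (u (fst q)) i (snd q)).

Definition time_function (kappa : R) (I : R -> Prop) (p : R -> sfun) : Prop :=
  forall c, smooth_on (V := RxR2) (fun q => I (fst q))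
              (fun q => p (fst q) (param kappa c (snd q))).

(** The function on the sphere whose coordinate expression in the chart [c] is
    [F c]. For a scalar the expressions agree where the charts overlap, so it
    does not matter which chart is used at a given point. *)
Definition glue (kappa : R) (F : chart -> R2 -> R) : sfun := fun X =>
  if Rle_dec 0 (X3 X) then F north (coord kappa north X)
  else F south (coord kappa south X).

Definition rot (kappa : R) (u : sfield) : sfun :=
  glue kappa (fun c => c_rot (metric kappa c) (comp kappa c u)).

Definition gdot (kappa : R) (u v : sfield) : sfun :=
  glue kappa
    (fun c => c_dot (metric kappa c) (comp kappa c u) (comp kappa c v)).

Definition killing (kappa : R) (u : sfield) : Prop :=
  forall c k j x, c_S (metric kappa c) (comp kappa c u) k j x = 0.

Definition navier_stokes (kappa mu : R) (I : R -> Prop)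
    (u : R -> sfield) (p : R -> sfun) : Prop :=
  forall t, I t -> forall (c : chart) (x : R2),
  let g := metric kappa c in
  let uc := fun s => comp kappa c (u s) in
  (forall j, Derive (fun s => uc s j x) t + c_convection g (uc t) j x
             - mu * c_L g (uc t) j x
             + c_grad g (fun y => p t (param kappa c y)) j x = 0) /\
  c_div g (uc t) x = 0.

(** Colatitude [theta] and longitude [phi]; the area form is
    r^2 sin theta dtheta dphi. *)
Definition spherical (kappa theta phi : R) : R3 :=
  let r := radius kappa in
  mkR3 (r * sin theta * cos phi) (r * sin theta * sin phi) (r * cos theta).

Definition integral (kappa : R) (f : sfun) : R :=
  RInt (fun theta =>
    RInt (fun phi => f (spherical kappa theta phi) * (radius kappa ^ 2 * sin theta))
      0 (2 * PI))
    0 PI.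

Definition inner_fun (kappa : R) (f h : sfun) : R :=
  integral kappa (fun X => f X * h X).

Definition inner_field (kappa : R) (u v : sfield) : R :=
  integral kappa (gdot kappa u v).

Lemma radius_pos (kappa : R) : 0 < kappa -> 0 < radius kappa.
Proof. intros H; apply Rinv_0_lt_compat, sqrt_lt_R0, H. Qed.

Lemma radius_sqr (kappa : R) : 0 < kappa -> radius kappa ^ 2 = / kappa.
Proof.
intros H; unfold radius; rewrite pow_inv; f_equal; apply pow2_sqrt; lra.
Qed.

Lemma param_on_sphere (kappa : R) (c : chart) (x : R2) :
  on_sphere kappa (param kappa c x).
Proof.
unfold on_sphere, dot3; destruct c, x as [a b]; cbn -[radius pow]; field; nra.
Qed.

Lemma coord_param (kappa : R) (c : chart) (x : R2) :
  0 < kappa -> coord kappa c (param kappa c x) = x.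
Proof.
intros H; pose proof (radius_pos kappa H) as Hr.
destruct c, x as [a b]; cbn -[radius pow];
  apply injective_projections; cbn -[radius pow]; field; split; nra.
Qed.

Lemma param_coord (kappa : R) (c : chart) (X : R3) :
  0 < kappa -> on_sphere kappa X ->
  match c with north => X3 X <> - radius kappa | south => X3 X <> radius kappa end ->
  param kappa c (coord kappa c X) = X.
Proof.
intros H HX HX3; pose proof (radius_pos kappa H) as Hr.
unfold on_sphere, dot3 in HX; destruct X as [p q s]; cbn -[radius pow] in *.
set (r := radius kappa) in *.
assert (E : q * q = r ^ 2 - p * p - s * s) by lra.
destruct c; cbn -[pow radius]; fold r.
- assert (D : 1 + (p / (r + s)) ^ 2 + (q / (r + s)) ^ 2 = 2 * r / (r + s)).
  { replace ((q / (r + s)) ^ 2) with (q * q / (r + s) ^ 2) by (field; lra).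
    rewrite E; field; lra. }
  rewrite D; f_equal; field; split; lra.
- assert (D : 1 + (p / (r - s)) ^ 2 + (- q / (r - s)) ^ 2 = 2 * r / (r - s)).
  { replace ((- q / (r - s)) ^ 2) with (q * q / (r - s) ^ 2) by (field; lra).
    rewrite E; field; lra. }
  rewrite D; f_equal; field; split; lra.
Qed.

(** The classical form of the metric of constant curvature kappa. *)
Lemma metricE (kappa : R) (c : chart) (i j : ix) (x : R2) :
  0 < kappa ->
  metric kappa c i j x =
  match i, j with
  | i1, i1 | i2, i2 => 4 / (kappa * (1 + fst x ^ 2 + snd x ^ 2) ^ 2)
  | _, _ => 0
  end.
Proof.
intros H; pose proof (radius_sqr kappa H) as Hr2.
destruct x as [a b].
assert (Hd : 0 < 1 + a ^ 2 + b ^ 2) by nra.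
assert (der : forall (f : R -> R) l, is_derive f 0 l -> Derive f 0 = l)
  by (intros; now apply is_derive_unique).
set (d := 1 + a ^ 2 + b ^ 2) in *.
assert (P : forall i, dparam kappa c i (a, b) =
  let r := radius kappa in
  let e := match c with north => 1 | south => -1 end in
  match i with
  | i1 => mkR3 (r * (2 * d - 4 * a ^ 2) / d ^ 2) (e * (- (4 * r * a * b) / d ^ 2))
            (e * (- (4 * r * a) / d ^ 2))
  | i2 => mkR3 (- (4 * r * a * b) / d ^ 2) (e * (r * (2 * d - 4 * b ^ 2) / d ^ 2))
            (e * (- (4 * r * b) / d ^ 2))
  end).
{ intros k; unfold dparam, pd, dirder; destruct c, k;
  cbn -[radius pow Derive]; f_equal; apply der;
  unfold plus, scal, mult; simpl; unfold mult; simpl;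
  auto_derive; try nra; unfold d; field; nra. }
unfold metric; rewrite !P; cbv zeta.
assert (Hr : 0 < radius kappa) by now apply radius_pos.
assert (Hk : kappa = / radius kappa ^ 2) by (rewrite Hr2, Rinv_inv; reflexivity).
set (r := radius kappa) in *; clearbody r; subst kappa.
destruct c, i, j; unfold dot3; cbn -[pow]; unfold d; field; nra.
Qed.

(* Main.v *)
From Stdlib Require Import Reals Lra FunctionalExtensionality.
From Coquelicot Require Import Coquelicot.
Require Import Defs.
Open Scope R_scope.

(** The rotation of a Killing field [u] is a first spherical harmonic, and the
    gradient of that function, turned by a right angle, is [u] again up to the
    factor 2 kappa. Integrating by parts, for every vector field [v],
<<
      < rot u, rot v > = < rot u, div (K v) > = - < grad (rot u), K v >
                       = 2 kappa < u, v >
>>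
    ([inner_rot_killing]). With [u] the Killing part and [v] the part orthogonal
    to the Killing fields, the right-hand side vanishes. That the vorticity is
    the sum of the two rotations is linearity ([rot_add]).

    Everything is computed in the two stereographic charts; upper indices on [u]
    and [v] denote components. There the metric is
    m (da^2 + db^2) with m = 4 / (kappa d^2) and d = 1 + a^2 + b^2, and the
    Killing equation says that the components of [u] satisfy the Cauchy-Riemann
    equations together with a formula for the diagonal derivatives
    ([killing_cauchy_riemann]). By the symmetry of second derivatives this
    determines both partial derivatives of h = rot u ([killing_rot_gradient]):
    they are (- 2 kappa m u^2, 2 kappa m u^1). Consequently the plane field
    (m h v^2, - m h v^1), which is the density of h K v, has divergence
    m (h rot v - 2 kappa g(u, v)).

    Each chart sends its hemisphere to the unit disk, and the integral over the
    sphere in colatitude and longitude is the sum of two integrals over that disk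
    ([integral_glue]). The divergence theorem on the disk, proved in polar
    coordinates ([divergence_disk]), leaves one flux through the equator for each
    chart ([killing_flux]). The two fluxes are opposite
    ([boundary_flux_cancel]), because vectors transform by the derivative of the
    transition map and because both charts compute the same h on the equator
    ([rot_equator]). *)

(** * Continuity and differentiability on the plane *)

Definition continuous_on_plane (f : R2 -> R) : Prop := forall x, continuous f x.

(** The general rules for sums and products concern the operations of modules and
    rings; these instances mention the operations of [R], so that they apply to
    real expressions as written. *)
Lemma continuous_Rconst {U : UniformSpace} (c : R) (x : U) :
  continuous (fun _ => c) x.
Proof. exact (continuous_const (V := R_UniformSpace) c x). Qed.

Lemma continuous_Rplus {U : UniformSpace} (f g : U -> R) x :
  continuous f x -> continuous g x -> continuous (fun y => f y + g y) x.
Proof. exact (continuous_plus (V := R_NormedModule) f g x). Qed.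

Lemma continuous_Ropp {U : UniformSpace} (f : U -> R) x :
  continuous f x -> continuous (fun y => - f y) x.
Proof. exact (continuous_opp (V := R_NormedModule) f x). Qed.

Lemma continuous_Rminus {U : UniformSpace} (f g : U -> R) x :
  continuous f x -> continuous g x -> continuous (fun y => f y - g y) x.
Proof. exact (continuous_minus (V := R_NormedModule) f g x). Qed.

Lemma continuous_Rmult {U : UniformSpace} (f g : U -> R) x :
  continuous f x -> continuous g x -> continuous (fun y => f y * g y) x.
Proof. exact (continuous_mult (K := R_AbsRing) f g x). Qed.

Lemma continuous_Rpow {U : UniformSpace} (f : U -> R) n x :
  continuous f x -> continuous (fun y => f y ^ n) x.
Proof.
intros Hf; induction n as [|n IH]; simpl.
- apply continuous_Rconst.
- now apply continuous_Rmult.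
Qed.

Lemma continuous_Rdiv {U : UniformSpace} (f g : U -> R) x :
  continuous f x -> continuous g x -> g x <> 0 ->
  continuous (fun y => f y / g y) x.
Proof.
intros Hf Hg Hx; apply continuous_Rmult; [exact Hf|].
apply (continuous_comp g Rinv); [exact Hg|]. now apply continuous_Rinv.
Qed.

Lemma continuous_at_pair {U : UniformSpace} (F : R2 -> R) (f g : U -> R) x :
  continuous_on_plane F -> continuous f x -> continuous g x ->
  continuous (fun y => F (f y, g y)) x.
Proof.
intros HF Hf Hg.
apply (continuous_comp_2 f g (fun a b => F (a, b)) x Hf Hg).
apply continuous_ext with (2 := HF (f x, g x)).
now intros [a b].
Qed.

(** The partial derivatives are parameters of the relation, not obtained from
    [pd], so that the rules below compute them together with the proof. *)
Definition is_C1 (f fa fb : R2 -> R) : Prop :=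
  (forall a b : R, is_derive (fun s => f (s, b)) a (fa (a, b))) /\
  (forall a b : R, is_derive (fun s => f (a, s)) b (fb (a, b))) /\
  continuous_on_plane fa /\ continuous_on_plane fb.

Ltac split_C1 := split; [|split; [|split]].

(** Continuity of one partial derivative and existence of the other suffice for
    total differentiability, which is what the chain rule needs. *)
Lemma is_C1_differentiable f fa fb a b :
  is_C1 f fa fb ->
  differentiable_pt_lim (fun x y => f (x, y)) a b (fa (a, b)) (fb (a, b)).
Proof.
intros (Ha & Hb & Ca & Cb).
apply filterdiff_differentiable_pt_lim.
apply (is_derive_filterdiff (fun x y => f (x, y)) a b (fun x y => fa (x, y))).
- apply filter_forall; intros [x y]; exact (Ha x y).
- apply Hb.
- apply continuous_ext with (2 := Ca (a, b)). now intros [x y].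
Qed.

Lemma is_C1_chain f fa fb (p q : R -> R) t dp dq :
  is_C1 f fa fb -> is_derive p t dp -> is_derive q t dq ->
  is_derive (fun s => f (p s, q s)) t (fa (p t, q t) * dp + fb (p t, q t) * dq).
Proof.
intros H Hp Hq; apply is_derive_Reals.
apply (derivable_pt_lim_comp_2d (fun x y => f (x, y)) p q).
- now apply is_C1_differentiable.
- now apply is_derive_Reals.
- now apply is_derive_Reals.
Qed.

Lemma is_C1_continuous {f fa fb} : is_C1 f fa fb -> continuous_on_plane f.
Proof.
intros H [a b].
pose proof (is_C1_differentiable f fa fb a b H) as D.
apply filterdiff_differentiable_pt_lim in D.
assert (K := filterdiff_continuous _ _ (ex_intro _ _ D)); clear D; rename K into D.
apply continuous_ext with (2 := D). now intros [x y].
Qed.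

Lemma is_C1_ext {f fa fb g ga gb} :
  is_C1 f fa fb ->
  (forall x, f x = g x) -> (forall x, fa x = ga x) -> (forall x, fb x = gb x) ->
  is_C1 g ga gb.
Proof.
intros H E Ea Eb.
apply functional_extensionality in E, Ea, Eb; now subst.
Qed.

Lemma is_C1_fst : is_C1 fst (fun _ => 1) (fun _ => 0).
Proof.
split_C1; intros; simpl; try (auto_derive; trivial; ring);
  intros x; apply (continuous_Rconst (U := R2)).
Qed.

Lemma is_C1_snd : is_C1 snd (fun _ => 0) (fun _ => 1).
Proof.
split_C1; intros; simpl; try (auto_derive; trivial; ring);
  intros x; apply (continuous_Rconst (U := R2)).
Qed.

Lemma is_C1_const c : is_C1 (fun _ => c) (fun _ => 0) (fun _ => 0).
Proof.
split_C1; intros; simpl; try (auto_derive; trivial; ring);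
  intros x; apply (continuous_Rconst (U := R2)).
Qed.

Lemma is_C1_plus {f fa fb g ga gb} :
  is_C1 f fa fb -> is_C1 g ga gb ->
  is_C1 (fun x => f x + g x) (fun x => fa x + ga x) (fun x => fb x + gb x).
Proof.
intros (Fa & Fb & CFa & CFb) (Ga & Gb & CGa & CGb).
split_C1; intros.
- apply (is_derive_plus (V := R_NormedModule)); auto.
- apply (is_derive_plus (V := R_NormedModule)); auto.
- intros x; now apply continuous_Rplus.
- intros x; now apply continuous_Rplus.
Qed.

Lemma is_C1_mult {f fa fb g ga gb} :
  is_C1 f fa fb -> is_C1 g ga gb ->
  is_C1 (fun x => f x * g x) (fun x => fa x * g x + f x * ga x)
     (fun x => fb x * g x + f x * gb x).
Proof.
intros F G.
pose proof (is_C1_continuous F) as CF; pose proof (is_C1_continuous G) as CG.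
destruct F as (Fa & Fb & CFa & CFb), G as (Ga & Gb & CGa & CGb).
split_C1; intros.
- apply (is_derive_mult (fun s => f (s, b)) (fun s => g (s, b))); auto; exact Rmult_comm.
- apply (is_derive_mult (fun s => f (a, s)) (fun s => g (a, s))); auto; exact Rmult_comm.
- intros x; apply continuous_Rplus; now apply continuous_Rmult.
- intros x; apply continuous_Rplus; now apply continuous_Rmult.
Qed.

Lemma is_C1_inv {f fa fb} :
  is_C1 f fa fb -> (forall x, f x <> 0) ->
  is_C1 (fun x => / f x) (fun x => - fa x / f x ^ 2) (fun x => - fb x / f x ^ 2).
Proof.
intros F N.
pose proof (is_C1_continuous F) as CF.
destruct F as (Fa & Fb & CFa & CFb).
assert (C : forall g : R2 -> R, continuous_on_plane g ->
          continuous_on_plane (fun x => - g x / f x ^ 2)).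
{ intros g Cg x; apply continuous_Rdiv.
  - now apply continuous_Ropp.
  - now apply continuous_Rpow.
  - now apply pow_nonzero. }
split_C1; intros; auto.
- now apply (is_derive_inv (fun s => f (s, b))).
- now apply (is_derive_inv (fun s => f (a, s))).
Qed.

Lemma is_C1_schwarz {f fa fb faa fab fba fbb} :
  is_C1 f fa fb -> is_C1 fa faa fab -> is_C1 fb fba fbb -> forall x, fab x = fba x.
Proof.
intros (Fa & Fb & _) (Faa & Fab & _ & CFab) (Fba & Fbb & CFba & _) [a b].
assert (Da : forall y z, Derive (fun t => f (t, z)) y = fa (y, z))
  by (intros; now apply is_derive_unique).
assert (Db : forall y z, Derive (fun t => f (y, t)) z = fb (y, z))
  by (intros; now apply is_derive_unique).
assert (Dab : forall y z, Derive (fun s => Derive (fun t => f (t, s)) y) z = fab (y, z)).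
{ intros; rewrite (Derive_ext _ (fun s => fa (y, s))) by auto.
  now apply is_derive_unique. }
assert (Dba : forall y z, Derive (fun s => Derive (fun t => f (s, t)) z) y = fba (y, z)).
{ intros; rewrite (Derive_ext _ (fun s => fb (s, z))) by auto.
  now apply is_derive_unique. }
rewrite <- Dab, <- Dba; symmetry.
apply (Schwarz (fun x y => f (x, y))).
- apply locally_2d_forall; intros y z; repeat split.
  + exists (fa (y, z)); apply Fa.
  + exists (fb (y, z)); apply Fb.
  + apply ex_derive_ext with (fun s => fb (s, z)); [now intros|].
    exists (fba (y, z)); apply Fba.
  + apply ex_derive_ext with (fun s => fa (y, s)); [now intros|].
    exists (fab (y, z)); apply Fab.
- apply continuity_2d_pt_filterlim. rewrite Dba.
  apply filterlim_ext with (2 := CFba (a, b)).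
  intros [y z]; simpl; now rewrite Dba.
- apply continuity_2d_pt_filterlim. rewrite Dab.
  apply filterlim_ext with (2 := CFab (a, b)).
  intros [y z]; simpl; now rewrite Dab.
Qed.

Notation smooth := (smooth_on (V := R2) (fun _ => True)).

Lemma smooth_pd i {f} : smooth f -> smooth (pd i f).
Proof. intros H n; exact (proj2 (proj2 (H (S n)) (basis i))). Qed.

Lemma smooth_is_C1 {f} : smooth f -> is_C1 f (pd i1 f) (pd i2 f).
Proof.
intros H.
assert (D : forall i x, is_derive (fun s => f (plus x (scal s (basis i)))) 0 (pd i f x)).
{ intros i x; apply Derive_correct. now apply (proj1 (proj2 (H 1%nat) (basis i)) x). }
(* Directional derivatives are taken at 0 along translated lines. *)
assert (sh : forall (h : R -> R) c l,
  is_derive (fun s => h (c + s)) 0 l -> is_derive h c l).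
{ intros h c l K.
  apply (is_derive_ext (fun s => (fun t => h (c + t)) (s - c))).
  { intros s; simpl; f_equal; ring. }
  replace l with (scal 1 l) by apply Rmult_1_l.
  apply (is_derive_comp (fun t => h (c + t)) (fun s => s - c)).
  - now replace (c - c) with 0 by ring.
  - auto_derive; trivial; ring. }
split_C1; try (intros x; apply (proj1 (smooth_pd _ H 0%nat) x I)).
- intros a b; apply sh; generalize (D i1 (a, b)); apply is_derive_ext.
  intros s; f_equal; apply injective_projections; cbn; unfold mult; cbn; ring.
- intros a b; apply sh; generalize (D i2 (a, b)); apply is_derive_ext.
  intros s; f_equal; apply injective_projections; cbn; unfold mult; cbn; ring.
Qed.

Lemma smooth_continuous {f} : smooth f -> continuous_on_plane f.
Proof. intros H x; exact (proj1 (H 0%nat) x I). Qed.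

Lemma pd_is_C1 {f fa fb} :
  is_C1 f fa fb -> pd i1 f = fa /\ pd i2 f = fb.
Proof.
intros H.
assert (D : forall i x, is_derive (fun s => f (plus x (scal s (basis i)))) 0
   (match i with i1 => fa x | i2 => fb x end)).
{ assert (L : forall a b p q : R, is_derive (fun s => f (a + s * p, b + s * q)) 0
     (fa (a, b) * p + fb (a, b) * q)).
  { intros a b p q.
    assert (K := is_C1_chain f fa fb (fun s => a + s * p) (fun s => b + s * q) 0 p q H).
    simpl in K; replace (a + 0 * p) with a in K by ring;
    replace (b + 0 * q) with b in K by ring.
    assert (Lin : forall c r : R, is_derive (fun s => c + s * r) 0 r)
      by (intros a' r; auto_derive; [trivial | apply Rmult_1_l]).
    apply K; apply Lin. }
  intros i [a b]; destruct i.
  - replace (fa (a, b)) with (fa (a, b) * 1 + fb (a, b) * 0) by ring; exact (L a b 1 0).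
  - replace (fb (a, b)) with (fa (a, b) * 0 + fb (a, b) * 1) by ring; exact (L a b 0 1). }
split; apply functional_extensionality; intros x; apply is_derive_unique.
- apply (D i1).
- apply (D i2).
Qed.

(** * The conformal factor of the stereographic charts *)

Definition stereo_den (x : R2) : R := 1 + fst x ^ 2 + snd x ^ 2.

Lemma stereo_den_pos x : 0 < stereo_den x.
Proof. unfold stereo_den; nra. Qed.

Lemma is_C1_stereo_den :
  is_C1 stereo_den (fun x => 2 * fst x) (fun x => 2 * snd x).
Proof.
apply (is_C1_ext (is_C1_plus (is_C1_plus (is_C1_const 1)
  (is_C1_mult is_C1_fst is_C1_fst)) (is_C1_mult is_C1_snd is_C1_snd)));
  intros; unfold stereo_den; ring.
Qed.

(** The partial derivatives of (1/2) log [conformal kappa], from which all the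
    Christoffel symbols are built. *)
Definition dlog (i : ix) (x : R2) : R :=
  - 2 * match i with i1 => fst x | i2 => snd x end / stereo_den x.

Lemma is_C1_dlog_1 :
  is_C1 (dlog i1) (fun x => -2 / stereo_den x + 4 * fst x ^ 2 / stereo_den x ^ 2)
                  (fun x => 4 * (fst x * snd x) / stereo_den x ^ 2).
Proof.
pose proof (fun x => Rgt_not_eq _ _ (stereo_den_pos x)) as N.
apply (is_C1_ext (is_C1_mult (is_C1_mult (is_C1_const (-2)) is_C1_fst)
  (is_C1_inv is_C1_stereo_den N))); intros x; pose proof (N x); unfold dlog; field; auto.
Qed.

Lemma is_C1_dlog_2 :
  is_C1 (dlog i2) (fun x => 4 * (fst x * snd x) / stereo_den x ^ 2)
    (fun x => -2 / stereo_den x + 4 * snd x ^ 2 / stereo_den x ^ 2).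
Proof.
pose proof (fun x => Rgt_not_eq _ _ (stereo_den_pos x)) as N.
apply (is_C1_ext (is_C1_mult (is_C1_mult (is_C1_const (-2)) is_C1_snd)
  (is_C1_inv is_C1_stereo_den N))); intros x; pose proof (N x); unfold dlog; field; auto.
Qed.

(** In both charts the metric is [conformal kappa] times the Euclidean one. *)
Definition conformal (kappa : R) (x : R2) : R := 4 / (kappa * stereo_den x ^ 2).

Lemma is_C1_conformal kappa :
  0 < kappa ->
  is_C1 (conformal kappa) (fun x => conformal kappa x * (2 * dlog i1 x))
                          (fun x => conformal kappa x * (2 * dlog i2 x)).
Proof.
intros Hk.
pose proof (fun x => Rgt_not_eq _ _ (stereo_den_pos x)) as N.
pose proof (is_C1_inv is_C1_stereo_den N) as I.
apply (is_C1_ext (is_C1_mult (is_C1_const (4 / kappa))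
  (is_C1_mult I I))); intros x; pose proof (N x);
  unfold conformal, dlog; field; split; auto; lra.
Qed.

Lemma conformal_pos kappa x : 0 < kappa -> 0 < conformal kappa x.
Proof.
intros; apply Rdiv_lt_0_compat; [lra|].
apply Rmult_lt_0_compat; [lra|]; apply pow_lt, stereo_den_pos.
Qed.

(** * Integrals depending on a parameter *)

Lemma ex_RInt_continuous_all (f : R -> R) a b :
  (forall x, continuous f x) -> ex_RInt f a b.
Proof. intros H; apply (ex_RInt_continuous (V := R_CompleteNormedModule)); auto. Qed.

Lemma continuous_slice (f : R2 -> R) (x : R) :
  continuous_on_plane f -> forall t, continuous (fun t => f (x, t)) t.
Proof.
intros Hf t; apply continuous_at_pair; auto.
- apply continuous_Rconst.
- apply continuous_id.
Qed.

(** A continuous integrand is uniformly continuous in the parameter along the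
    compact segment of integration. *)
Lemma continuous_RInt_param (f : R2 -> R) (a b : R) :
  a <= b -> continuous_on_plane f ->
  forall x, continuous (fun x => RInt (fun t => f (x, t)) a b) x.
Proof.
intros Hab Hf x.
apply (filterlim_locally (F := locally x)); intros eps.
(* The 1 keeps the quotient meaningful when a = b. *)
assert (He : 0 < eps / (b - a + 1)) by (apply Rdiv_lt_0_compat; [apply eps | lra]).
destruct (uniform_continuity_2d_1d' (fun y t => f (y, t)) a b x) with
  (eps := mkposreal _ He) as [delta Hd].
{ intros t _; apply continuity_2d_pt_filterlim.
  apply filterlim_ext with (2 := Hf (x, t)); now intros []. }
exists delta; intros y Hy.
change (Rabs (y - x) < delta) in Hy.
change (Rabs (RInt (fun t => f (y, t)) a b - RInt (fun t => f (x, t)) a b) < eps).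
rewrite <- (RInt_minus (V := R_CompleteNormedModule) (fun t => f (y, t)))
  by now apply ex_RInt_continuous_all, continuous_slice.
apply Rle_lt_trans with ((b - a) * (eps / (b - a + 1))).
- apply abs_RInt_le_const; auto.
  + apply ex_RInt_continuous_all; intros t.
    apply continuous_Rminus; now apply continuous_slice.
  + intros t Ht; apply Rlt_le.
    apply Rabs_def2 in Hy; pose proof (cond_pos delta).
    apply (Hd t x t y); auto; try lra.
    unfold Rminus; rewrite Rplus_opp_r, Rabs_R0; lra.
- apply Rlt_le_trans with ((b - a + 1) * (eps / (b - a + 1))).
  + apply Rmult_lt_compat_r; lra.
  + right; field; lra.
Qed.

Lemma is_derive_RInt_param_C1 (f df : R2 -> R) (a b : R) :
  a <= b ->
  (forall x t : R, is_derive (fun s => f (s, t)) x (df (x, t))) ->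
  continuous_on_plane f -> continuous_on_plane df ->
  forall x, is_derive (fun x => RInt (fun t => f (x, t)) a b) x
                      (RInt (fun t => df (x, t)) a b).
Proof.
intros Hab D Cf Cdf x.
assert (E : forall y t, Derive (fun s => f (s, t)) y = df (y, t))
  by (intros; now apply is_derive_unique).
rewrite <- (RInt_ext (fun t => Derive (fun s => f (s, t)) x)) by (intros; apply E).
apply (is_derive_RInt_param (fun y t => f (y, t))).
- apply filter_forall; intros y t _; exists (df (y, t)); apply D.
- intros t _; apply continuity_2d_pt_filterlim; rewrite E.
  apply filterlim_ext with (2 := Cdf (x, t)); intros []; simpl; now rewrite E.
- apply filter_forall; intros y; now apply ex_RInt_continuous_all, continuous_slice.
Qed.

(** * The divergence theorem on the unit disk *)

(** For [e] = -1 the angle runs clockwise. Longitude does so in the south chart,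
    whose second axis is reversed. *)
Definition polar (e : R) (q : R2) : R2 :=
  (fst q * cos (snd q), e * (fst q * sin (snd q))).

Definition int_disk (e : R) (F : R2 -> R) : R :=
  RInt (fun rho => RInt (fun phi => rho * F (polar e (rho, phi))) 0 (2 * PI)) 0 1.

Lemma continuous_plane_fst : continuous_on_plane fst.
Proof. intros [a b]; apply continuous_fst. Qed.

Lemma continuous_plane_snd : continuous_on_plane snd.
Proof. intros [a b]; apply continuous_snd. Qed.

Lemma continuous_cos_snd : continuous_on_plane (fun q => cos (snd q)).
Proof.
intros x; apply (continuous_comp snd cos);
  [apply continuous_plane_snd | apply continuous_cos].
Qed.

Lemma continuous_sin_snd : continuous_on_plane (fun q => sin (snd q)).
Proof.
intros x; apply (continuous_comp snd sin);
  [apply continuous_plane_snd | apply continuous_sin].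
Qed.

Lemma continuous_polar e F :
  continuous_on_plane F -> continuous_on_plane (fun q => F (polar e q)).
Proof.
intros HF x; apply continuous_at_pair; auto.
- apply continuous_Rmult; [apply continuous_plane_fst | apply continuous_cos_snd].
- apply continuous_Rmult; [apply continuous_Rconst|].
  apply continuous_Rmult; [apply continuous_plane_fst | apply continuous_sin_snd].
Qed.

(** The patterns are matched syntactically: plain [apply] would look for sums and
    products by unfolding the real operations. *)
Ltac plane_continuity :=
  let x := fresh in
  intros x;
  repeat lazymatch goal with
  | |- continuous (fun q => @?f q + @?g q) _ => apply (continuous_Rplus f g)
  | |- continuous (fun q => @?f q - @?g q) _ => apply (continuous_Rminus f g)
  | |- continuous (fun q => @?f q * @?g q) _ => apply (continuous_Rmult f g)
  | |- continuous (fun q => - @?f q) _ => apply (continuous_Ropp f)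
  | |- continuous (fun _ => ?c) _ => apply (continuous_Rconst c)
  | |- continuous (fun q => fst q) _ => apply continuous_plane_fst
  | |- continuous (fun q => cos (snd q)) _ => apply continuous_cos_snd
  | |- continuous (fun q => sin (snd q)) _ => apply continuous_sin_snd
  | |- continuous (fun q => ?F (polar ?e q)) _ =>
      apply (continuous_polar e F); assumption
  | H : continuous_on_plane ?f |- continuous (fun q => ?f q) _ => exact (H x)
  end.

Lemma int_disk_linear e F G k :
  continuous_on_plane F -> continuous_on_plane G ->
  int_disk e (fun x => F x - k * G x) = int_disk e F - k * int_disk e G.
Proof.
intros HF HG.
assert (C : forall H, continuous_on_plane H -> continuous_on_plane
   (fun q => fst q * H (polar e q))) by (intros H HH; plane_continuity).
assert (Ci : forall H, continuous_on_plane H -> forall rho,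
  ex_RInt (fun phi => rho * H (polar e (rho, phi))) 0 (2 * PI)).
{ intros H HH rho; apply ex_RInt_continuous_all, (continuous_slice _ rho (C H HH)). }
assert (Co : forall H, continuous_on_plane H -> ex_RInt (fun rho =>
  RInt (fun phi => rho * H (polar e (rho, phi))) 0 (2 * PI)) 0 1).
{ intros H HH; apply ex_RInt_continuous_all.
  apply (continuous_RInt_param (fun q => fst q * H (polar e q)) 0 (2 * PI));
    [pose proof PI_RGT_0; lra | exact (C H HH)]. }
unfold int_disk.
rewrite <- (RInt_scal (V := R_CompleteNormedModule) _ _ _ k) by auto.
rewrite <- (RInt_minus (V := R_CompleteNormedModule)); auto.
2: { apply (ex_RInt_scal (V := R_NormedModule)); auto. }
apply RInt_ext; intros rho _.
rewrite <- (RInt_scal (V := R_CompleteNormedModule) _ _ _ k) by auto.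
rewrite <- (RInt_minus (V := R_CompleteNormedModule)); auto.
2: { apply (ex_RInt_scal (V := R_NormedModule)); auto. }
apply RInt_ext; intros phi _.
unfold minus, plus, opp, scal; simpl; unfold mult; simpl; ring.
Qed.

Lemma is_derive_polar_radius e {F Fa Fb} (rho phi : R) :
  is_C1 F Fa Fb ->
  is_derive (fun s : R => F (polar e (s, phi))) rho
    (Fa (polar e (rho, phi)) * cos phi + Fb (polar e (rho, phi)) * (e * sin phi)).
Proof.
intros H; unfold polar; simpl.
apply (is_C1_chain F Fa Fb (fun s => s * cos phi) (fun s => e * (s * sin phi))); auto;
  auto_derive; trivial; ring.
Qed.

Lemma is_derive_polar_angle e {F Fa Fb} (rho phi : R) :
  is_C1 F Fa Fb ->
  is_derive (fun s : R => F (polar e (rho, s))) phi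
    (Fa (polar e (rho, phi)) * (- rho * sin phi)
     + Fb (polar e (rho, phi)) * (e * (rho * cos phi))).
Proof.
intros H; unfold polar; simpl.
apply (is_C1_chain F Fa Fb (fun s => rho * cos s) (fun s => e * (rho * sin s))); auto;
  auto_derive; trivial; ring.
Qed.

(** Along the circle of radius rho write the field in its outward and angular
    components. Its divergence times rho is the radial derivative of rho times
    the outward component plus the angular derivative of the angular one. The
    latter integrates to zero over a full turn, and the former leaves the outward
    flux through the unit circle. The sign [e] does not change the outward normal
    at a point, only the angle at which the point is reached. *)
Theorem divergence_disk e P Pa Pb Q Qa Qb :
  e * e = 1 -> is_C1 P Pa Pb -> is_C1 Q Qa Qb ->
  int_disk e (fun x => Pa x + Qb x) =
  RInt (fun phi => P (polar e (1, phi)) * cos phi + e * Q (polar e (1, phi)) * sin phi)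
    0 (2 * PI).
Proof.
intros He HP HQ.
pose proof (is_C1_continuous HP) as CP; pose proof (is_C1_continuous HQ) as CQ.
pose proof (proj2 (proj2 HP)) as [CPa CPb].
pose proof (proj2 (proj2 HQ)) as [CQa CQb].
set (radial := fun q : R2 =>
  P (polar e q) * cos (snd q) + e * Q (polar e q) * sin (snd q)).
set (angular := fun q : R2 =>
  - P (polar e q) * sin (snd q) + e * Q (polar e q) * cos (snd q)).
set (dradial := fun q : R2 =>
  (Pa (polar e q) * cos (snd q) + e * Pb (polar e q) * sin (snd q)) * cos (snd q)
  + e * (Qa (polar e q) * cos (snd q) + e * Qb (polar e q) * sin (snd q)) * sin (snd q)).
(* The formula for the divergence in polar coordinates, solved for the angular
   derivative. *)
set (dangular := fun q : R2 =>
  fst q * (Pa (polar e q) + Qb (polar e q)) - (radial q + fst q * dradial q)).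
assert (Crad : continuous_on_plane radial) by (unfold radial; plane_continuity).
assert (Cdrad : continuous_on_plane dradial) by (unfold dradial; plane_continuity).
assert (Cdiv : continuous_on_plane (fun q => fst q * (Pa (polar e q) + Qb (polar e q))))
  by plane_continuity.
assert (Cang : continuous_on_plane dangular) by (unfold dangular; plane_continuity).
assert (Hrad : forall rho phi : R,
  is_derive (fun s => s * radial (s, phi)) rho
    (radial (rho, phi) + rho * dradial (rho, phi))).
{ intros rho phi.
  replace (radial (rho, phi) + rho * dradial (rho, phi)) with
    (1 * radial (rho, phi) + rho * dradial (rho, phi)) by ring.
  apply (is_derive_mult (fun s : R => s) (fun s => radial (s, phi)));
    [apply (is_derive_id (K := R_AbsRing)) | | exact Rmult_comm].
  pose proof (is_derive_polar_radius e rho phi HP) as DP.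
  pose proof (is_derive_polar_radius e rho phi HQ) as DQ.
  assert (L : forall (p q : R -> R) dp dq c d,
    is_derive p rho dp -> is_derive q rho dq ->
    is_derive (fun s => p s * c + e * q s * d) rho (dp * c + e * dq * d)).
  { intros p q dp dq c d Hp Hq.
    auto_derive; [repeat split; eexists; eassumption|].
    assert (Ep : Derive (fun x : R => p x) rho = dp) by now apply is_derive_unique.
    assert (Eq : Derive (fun x : R => q x) rho = dq) by now apply is_derive_unique.
    rewrite Ep, Eq; ring. }
  eapply (eq_ind _ (is_derive _ _)); [exact (L _ _ _ _ (cos phi) (sin phi) DP DQ)|].
  unfold dradial; simpl; ring. }
assert (Hang : forall rho phi : R,
  is_derive (fun s => angular (rho, s)) phi (dangular (rho, phi))).
{ intros rho phi.
  pose proof (is_derive_polar_angle e rho phi HP) as DP.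
  pose proof (is_derive_polar_angle e rho phi HQ) as DQ.
  assert (L : forall (p q : R -> R) dp dq,
    is_derive p phi dp -> is_derive q phi dq ->
    is_derive (fun s => - p s * sin s + e * q s * cos s) phi
      (- dp * sin phi - p phi * cos phi + e * (dq * cos phi - q phi * sin phi))).
  { intros p q dp dq Hp Hq.
    auto_derive; [repeat split; eexists; eassumption|].
    assert (Ep : Derive (fun x : R => p x) phi = dp) by now apply is_derive_unique.
    assert (Eq : Derive (fun x : R => q x) phi = dq) by now apply is_derive_unique.
    rewrite Ep, Eq; ring. }
  eapply (eq_ind _ (is_derive _ _)); [exact (L _ _ _ _ DP DQ)|].
  unfold dangular, radial, dradial; simpl.
  pose proof (sin2_cos2 phi) as T; unfold Rsqr in T.
  set (pa := Pa _); set (pb := Pb _); set (qa := Qa _); set (qb := Qb _).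
  set (p := P _); set (q := Q _).
  clearbody pa pb qa qb p q.
  set (c := cos phi) in *; set (s := sin phi) in *.
  assert (T' : s * s = 1 - c * c) by lra.
  ring [He T']. }
assert (Hpi : 0 <= 2 * PI) by (pose proof PI_RGT_0; lra).
assert (E : forall rho,
  RInt (fun phi => rho * (Pa (polar e (rho, phi)) + Qb (polar e (rho, phi)))) 0 (2 * PI)
  = RInt (fun phi => radial (rho, phi) + rho * dradial (rho, phi)) 0 (2 * PI)).
{ intros rho.
  assert (Z : RInt (fun phi => dangular (rho, phi)) 0 (2 * PI) = 0).
  { apply (is_RInt_unique (V := R_CompleteNormedModule)).
    replace 0 with (minus (angular (rho, 2 * PI)) (angular (rho, 0))) at 2.
    - apply (is_RInt_derive (V := R_CompleteNormedModule)
               (fun s => angular (rho, s)) (fun s => dangular (rho, s))).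
      + intros; apply Hang.
      + intros; now apply continuous_slice.
    - unfold angular, polar; simpl; rewrite cos_2PI, sin_2PI, cos_0, sin_0.
      apply (plus_opp_r (G := R_AbelianGroup)). }
  unfold dangular in Z; simpl in Z.
  rewrite (RInt_minus (V := R_CompleteNormedModule)) in Z.
  - unfold minus, plus, opp in Z; simpl in Z; lra.
  - apply ex_RInt_continuous_all. apply (continuous_slice _ rho Cdiv).
  - apply ex_RInt_continuous_all.
    apply (continuous_slice (fun q => radial q + fst q * dradial q)); plane_continuity. }
unfold int_disk.
rewrite (RInt_ext _ (fun rho =>
    RInt (fun phi => radial (rho, phi) + rho * dradial (rho, phi)) 0 (2 * PI)))
  by (intros; apply E).
assert (Cs : continuous_on_plane (fun q : R2 => fst q * radial q))
  by plane_continuity.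
assert (Cds : continuous_on_plane (fun q : R2 => radial q + fst q * dradial q))
  by plane_continuity.
apply (is_RInt_unique (V := R_CompleteNormedModule)).
replace (RInt _ 0 (2 * PI)) with
  (minus (RInt (fun phi => 1 * radial (1, phi)) 0 (2 * PI))
         (RInt (fun phi => 0 * radial (0, phi)) 0 (2 * PI))).
- apply (is_RInt_derive (V := R_CompleteNormedModule)
    (fun rho => RInt (fun phi => rho * radial (rho, phi)) 0 (2 * PI))).
  + intros rho _.
    apply (is_derive_RInt_param_C1 (fun q => fst q * radial q)
             (fun q => radial q + fst q * dradial q)); auto.
  + intros rho _.
    apply (continuous_RInt_param (fun q => radial q + fst q * dradial q)); auto.
- rewrite (RInt_ext (fun phi => 0 * radial (0, phi)) (fun _ => 0))
    by (intros; apply Rmult_0_l).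
  rewrite RInt_const.
  rewrite (RInt_ext (fun phi => 1 * radial (1, phi)) (fun phi => radial (1, phi)))
    by (intros; apply Rmult_1_l).
  unfold minus, plus, opp, scal; simpl; unfold mult; simpl.
  unfold radial; simpl; ring.
Qed.
(** * The integral over the sphere as two integrals over the disk *)

(** The direction in which the longitude turns in the chart. *)
Definition handedness (c : chart) : R := match c with north => 1 | south => -1 end.

Definition int_chart (kappa : R) (c : chart) (F : R2 -> R) : R :=
  int_disk (handedness c) (fun x => conformal kappa x * F x).

Lemma handedness_sqr c : handedness c * handedness c = 1.
Proof. destruct c; simpl; ring. Qed.

(** This is tan (theta / 2) in the north chart and cot (theta / 2) in the south
    one, as for any stereographic projection. *)
Definition chart_radius (c : chart) (theta : R) : R :=
  sin theta / (1 + handedness c * cos theta).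

Lemma chart_cos_pos c theta :
  match c with north => 0 <= theta <= PI / 2 | south => PI / 2 <= theta <= PI end ->
  0 < 1 + handedness c * cos theta.
Proof.
pose proof PI_RGT_0.
destruct c; simpl; intros Hth.
- assert (0 <= cos theta) by (apply cos_ge_0; lra). lra.
- assert (cos theta <= 0) by (apply cos_le_0; lra). lra.
Qed.

Lemma is_derive_chart_radius c theta :
  0 < 1 + handedness c * cos theta ->
  is_derive (chart_radius c) theta (handedness c / (1 + handedness c * cos theta)).
Proof.
intros H; unfold chart_radius.
pose proof (sin2_cos2 theta) as T; unfold Rsqr in T.
pose proof (handedness_sqr c) as E.
auto_derive; [lra|].
set (e := handedness c) in *; set (s := sin theta) in *; set (k := cos theta) in *.
clearbody e s k.
assert (T' : s * s = 1 - k * k) by lra.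
apply Rmult_eq_reg_r with ((1 + e * k) * (1 + e * k)); [|nra].
field_simplify; try lra.
ring [E T'].
Qed.

Lemma coord_spherical kappa c theta phi :
  0 < kappa -> 0 < 1 + handedness c * cos theta ->
  coord kappa c (spherical kappa theta phi)
  = polar (handedness c) (chart_radius c theta, phi).
Proof.
intros Hk H; pose proof (radius_pos kappa Hk) as Hr.
unfold polar, chart_radius.
destruct c; cbn -[radius] in *; apply injective_projections; cbn -[radius];
  field; split; try lra; nra.
Qed.

(** The spherical area form is the form conformal * rho d rho d phi of the chart.
    In the south chart the radius decreases with the colatitude, whence the first
    factor [handedness c]. *)
Lemma area_density kappa c theta phi :
  0 < kappa -> 0 < 1 + handedness c * cos theta ->
  radius kappa ^ 2 * sin theta =
  handedness c * (handedness c / (1 + handedness c * cos theta) *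
  (chart_radius c theta
     * conformal kappa (polar (handedness c) (chart_radius c theta, phi)))).
Proof.
intros Hk H; rewrite radius_sqr by exact Hk.
pose proof (handedness_sqr c) as E.
pose proof (sin2_cos2 theta) as T; pose proof (sin2_cos2 phi) as T'.
unfold Rsqr in T, T'.
assert (D : stereo_den (polar (handedness c) (chart_radius c theta, phi))
          = 2 / (1 + handedness c * cos theta)).
{ unfold stereo_den, polar; cbn -[pow handedness chart_radius].
  replace (1 + _ + _) with (1 + chart_radius c theta ^ 2 *
   (cos phi * cos phi + (handedness c * handedness c) * (sin phi * sin phi))) by ring.
  replace (cos phi * cos phi) with (1 - sin phi * sin phi) by lra.
  rewrite E; unfold chart_radius.
  set (e := handedness c) in *; set (s := sin theta) in *; set (k := cos theta) in *.
  assert (S : s * s = 1 - k * k) by lra.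
  field_simplify_eq; [|lra]. ring [E S]. }
unfold conformal; rewrite D; unfold chart_radius.
set (e := handedness c) in *.
field_simplify_eq; [ring [E] | split; lra].
Qed.

Lemma glue_spherical kappa F c theta phi :
  0 < kappa ->
  match c with north => 0 < theta < PI / 2 | south => PI / 2 < theta < PI end ->
  glue kappa F (spherical kappa theta phi)
  = F c (polar (handedness c) (chart_radius c theta, phi)).
Proof.
intros Hk Hth; pose proof (radius_pos kappa Hk) as Hr; pose proof PI_RGT_0.
rewrite <- (coord_spherical kappa) by
  (auto; apply chart_cos_pos; destruct c; lra).
unfold glue; destruct Rle_dec as [H0|H0]; cbn -[radius coord] in H0;
  destruct c; auto; exfalso.
- assert (cos theta < 0) by (apply cos_lt_0; lra). nra.
- apply H0; assert (0 < cos theta) by (apply cos_gt_0; lra). nra.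
Qed.

(** Substitution of the polar radius of the chart for the colatitude. The equator
    is excluded from [glue_spherical] and is negligible for the integral. *)
Lemma is_RInt_hemisphere kappa F c :
  0 < kappa -> continuous_on_plane (F c) ->
  is_RInt (fun theta => RInt (fun phi =>
      glue kappa F (spherical kappa theta phi) * (radius kappa ^ 2 * sin theta))
      0 (2 * PI))
    match c with north => 0 | south => PI / 2 end
    match c with north => PI / 2 | south => PI end
    (int_chart kappa c (F c)).
Proof.
intros Hk HF.
pose proof PI_RGT_0 as Hpi.
set (lo := match c with north => 0 | south => PI / 2 end).
set (hi := match c with north => PI / 2 | south => PI end).
assert (Hlh : lo <= hi) by (unfold lo, hi; destruct c; lra).
set (G := fun x => conformal kappa x * F c x).
assert (CG : continuous_on_plane G).
{ intros x; apply continuous_Rmult; [|apply HF].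
  apply (is_C1_continuous (is_C1_conformal kappa Hk)). }
set (e := handedness c).
set (S := fun rho => RInt (fun phi => rho * G (polar e (rho, phi))) 0 (2 * PI)).
assert (CSphi : forall rho, ex_RInt (fun phi => rho * G (polar e (rho, phi))) 0 (2 * PI)).
{ intros rho; apply ex_RInt_continuous_all.
  apply (continuous_slice (fun q => fst q * G (polar e q))). plane_continuity. }
assert (CS : forall rho, continuous S rho).
{ apply (continuous_RInt_param (fun q => fst q * G (polar e q))); [lra|].
  plane_continuity. }
assert (Hint : forall th, lo <= th <= hi -> 0 < 1 + e * cos th).
{ intros th Hth; apply chart_cos_pos; unfold lo, hi in Hth; destruct c; lra. }
apply (is_RInt_ext (V := R_NormedModule)
  (fun theta => scal (e / (1 + e * cos theta)) (e * S (chart_radius c theta)))).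
{ rewrite Rmin_left, Rmax_right by exact Hlh; intros th Hth.
  unfold S.
  rewrite <- (RInt_scal (V := R_CompleteNormedModule) _ _ _ e) by apply CSphi.
  rewrite <- (RInt_scal (V := R_CompleteNormedModule)).
  2: { apply (ex_RInt_scal (V := R_NormedModule)). apply CSphi. }
  apply RInt_ext; intros phi _.
  rewrite (glue_spherical kappa F c) by (auto; unfold lo, hi in Hth; destruct c; lra).
  rewrite (area_density kappa c th phi) by (auto; apply Hint; lra).
  unfold G, e, scal; simpl; unfold mult; simpl; ring. }
replace (int_chart kappa c (F c)) with
  (RInt (fun rho => e * S rho) (chart_radius c lo) (chart_radius c hi)).
- apply (is_RInt_comp (V := R_CompleteNormedModule) (fun rho => e * S rho)
     (chart_radius c) (fun th => e / (1 + e * cos th))).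
  + intros; apply continuous_Rmult; [apply continuous_Rconst | apply CS].
  + rewrite Rmin_left, Rmax_right by exact Hlh; intros th Hth; split.
    * now apply is_derive_chart_radius, Hint.
    * apply continuous_Rdiv; [apply continuous_Rconst| |].
      -- apply continuous_Rplus; [apply continuous_Rconst|].
         apply continuous_Rmult; [apply continuous_Rconst|apply continuous_cos].
      -- pose proof (Hint th Hth); lra.
- rewrite (RInt_scal (V := R_CompleteNormedModule) S _ _ e).
  2: { now apply ex_RInt_continuous_all. }
  change (int_chart kappa c (F c)) with (RInt S 0 1).
  unfold lo, hi, e, chart_radius; destruct c; simpl handedness.
  + rewrite sin_0, cos_0, sin_PI2, cos_PI2.
    replace (0 / (1 + 1 * 1)) with 0 by field.
    replace (1 / (1 + 1 * 0)) with 1 by field.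
    apply Rmult_1_l.
  (* The radius runs from 1 down to 0, and [e] = -1 restores the orientation. *)
  + rewrite sin_PI, cos_PI, sin_PI2, cos_PI2.
    replace (0 / (1 + -1 * -1)) with 0 by field.
    replace (1 / (1 + -1 * 0)) with 1 by field.
    rewrite <- (opp_RInt_swap (V := R_CompleteNormedModule)).
    * unfold scal, opp; simpl; unfold mult; simpl; ring.
    * now apply ex_RInt_continuous_all.
Qed.

Theorem integral_glue kappa F :
  0 < kappa -> (forall c, continuous_on_plane (F c)) ->
  integral kappa (glue kappa F)
  = int_chart kappa north (F north) + int_chart kappa south (F south).
Proof.
intros Hk HF.
apply (is_RInt_unique (V := R_CompleteNormedModule)).
apply (is_RInt_Chasles (V := R_NormedModule)) with (PI / 2).
- now apply (is_RInt_hemisphere kappa F north).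
- now apply (is_RInt_hemisphere kappa F south).
Qed.

(** * The differential operators in a stereographic chart *)

Definition delta (i j : ix) : R :=
  match i, j with i1, i1 | i2, i2 => 1 | _, _ => 0 end.

Lemma metric_conformal kappa (Hk : 0 < kappa) c i j :
  metric kappa c i j = fun x => delta i j * conformal kappa x.
Proof.
apply functional_extensionality; intros x; rewrite metricE by exact Hk.
unfold conformal, stereo_den; destruct i, j; simpl delta; ring.
Qed.

Lemma pd_metric kappa (Hk : 0 < kappa) c k i j x :
  pd k (metric kappa c i j) x = delta i j * (conformal kappa x * (2 * dlog k x)).
Proof.
rewrite (metric_conformal kappa Hk).
pose proof (is_C1_mult (is_C1_const (delta i j)) (is_C1_conformal kappa Hk)) as M.
apply pd_is_C1 in M; destruct M as [M1 M2]; destruct k; [rewrite M1 | rewrite M2]; ring.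
Qed.

Lemma detg_conformal kappa (Hk : 0 < kappa) c x :
  detg (metric kappa c) x = conformal kappa x * conformal kappa x.
Proof. unfold detg; rewrite !(metric_conformal kappa Hk); simpl; ring. Qed.

Lemma ginv_conformal kappa (Hk : 0 < kappa) c i j x :
  ginv (metric kappa c) i j x = delta i j / conformal kappa x.
Proof.
pose proof (conformal_pos kappa x Hk).
destruct i, j; simpl;
  rewrite (detg_conformal kappa Hk), (metric_conformal kappa Hk); simpl; field; lra.
Qed.

Lemma christoffel_conformal kappa (Hk : 0 < kappa) c k i j x :
  christoffel (metric kappa c) k i j x =
  delta k i * dlog j x + delta k j * dlog i x - delta i j * dlog k x.
Proof.
pose proof (conformal_pos kappa x Hk).
unfold christoffel, sum; rewrite !(ginv_conformal kappa Hk), !(pd_metric kappa Hk).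
destruct k, i, j; simpl; field; lra.
Qed.

(** The conformal factors of the inverse metric and of the area form cancel: a
    turn by a right angle looks the same in any conformal chart. *)
Lemma c_K_conformal kappa (Hk : 0 < kappa) c u :
  c_K (metric kappa c) u =
  fun k => match k with i1 => u i2 | i2 => fun x => - u i1 x end.
Proof.
apply functional_extensionality; intros k; apply functional_extensionality; intros x.
pose proof (conformal_pos kappa x Hk).
unfold c_K, sum, c_eps; rewrite !(ginv_conformal kappa Hk), (detg_conformal kappa Hk).
rewrite sqrt_square by lra.
destruct k; simpl; field; lra.
Qed.

Lemma pd_opp i f x : pd i (fun y => - f y) x = - pd i f x.
Proof. unfold pd, dirder; apply Derive_opp. Qed.

Lemma c_rot_conformal kappa (Hk : 0 < kappa) c u x :
  c_rot (metric kappa c) u x = pd i1 (u i2) x - pd i2 (u i1) x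
                + 2 * (dlog i1 x * u i2 x - dlog i2 x * u i1 x).
Proof.
unfold c_rot, c_div, cov, sum.
rewrite (c_K_conformal kappa Hk), !(christoffel_conformal kappa Hk), pd_opp.
simpl; ring.
Qed.

Lemma c_dot_conformal kappa (Hk : 0 < kappa) c u v x :
  c_dot (metric kappa c) u v x = conformal kappa x * (u i1 x * v i1 x + u i2 x * v i2 x).
Proof. unfold c_dot, sum; rewrite !(metric_conformal kappa Hk); simpl; ring. Qed.

(** Raising an index with the conformal metric is a rescaling, so the Killing
    equation is the vanishing of the symmetrized covariant derivative. The
    Christoffel terms of its off-diagonal entry cancel, and both diagonal entries
    have the same ones. *)
Lemma killing_cauchy_riemann kappa (Hk : 0 < kappa) c u x :
  (forall k j, c_S (metric kappa c) u k j x = 0) ->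
  pd i1 (u i1) x = - (dlog i1 x * u i1 x + dlog i2 x * u i2 x) /\
  pd i2 (u i2) x = - (dlog i1 x * u i1 x + dlog i2 x * u i2 x) /\
  pd i2 (u i1) x = - pd i1 (u i2) x.
Proof.
intros S; pose proof (conformal_pos kappa x Hk) as Hm.
assert (E : forall k j, cov (metric kappa c) u j k x + cov (metric kappa c) u k j x = 0).
{ intros k j; specialize (S k j); unfold c_S, sum in S.
  rewrite !(ginv_conformal kappa Hk) in S.
  apply Rmult_eq_reg_r with (/ conformal kappa x); [|now apply Rinv_neq_0_compat; lra].
  rewrite Rmult_0_l, <- S; destruct k, j; simpl; field; lra. }
pose proof (E i1 i1) as E11; pose proof (E i1 i2) as E12; pose proof (E i2 i2) as E22.
unfold cov, sum in *; rewrite !(christoffel_conformal kappa Hk) in *; simpl in *.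
repeat split; lra.
Qed.

(** * The vorticity of a Killing field *)

(** With s = d_1 u^2 and q the common value of d_1 u^1 and d_2 u^2, equality of the
    mixed derivatives of u^1 and of u^2 gives d_1 s = - d_2 q and d_2 s = d_1 q.
    The derivatives of q are of first order in u; a second use of the
    Cauchy-Riemann equations leaves only u and s in them, and the terms in s
    cancel in the gradient of the rotation. *)
Lemma killing_rot_gradient kappa c u :
  0 < kappa -> (forall i, smooth (u i)) ->
  (forall k j x, c_S (metric kappa c) u k j x = 0) ->
  is_C1 (c_rot (metric kappa c) u)
    (fun x => - (2 * kappa * conformal kappa x * u i2 x))
    (fun x => 2 * kappa * conformal kappa x * u i1 x).
Proof.
intros Hk Hu HS.
pose proof (fun x => killing_cauchy_riemann kappa Hk c u x (fun k j => HS k j x)) as CR.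
pose proof (fun x => Rgt_not_eq _ _ (stereo_den_pos x)) as N.
set (s := pd i1 (u i2)) in *.
set (q := fun x => -1 * (dlog i1 x * u i1 x + dlog i2 x * u i2 x)).
assert (E11 : pd i1 (u i1) = q)
  by (apply functional_extensionality; intros x;
      unfold q; rewrite (proj1 (CR x)); ring).
assert (E22 : pd i2 (u i2) = q)
  by (apply functional_extensionality; intros x;
      unfold q; rewrite (proj1 (proj2 (CR x))); ring).
assert (E21 : pd i2 (u i1) = fun x => -1 * s x)
  by (apply functional_extensionality; intros x;
      rewrite (proj2 (proj2 (CR x))); ring).
pose proof (smooth_is_C1 (Hu i1)) as C1u.
pose proof (smooth_is_C1 (Hu i2)) as C2u.
pose proof (smooth_is_C1 (smooth_pd i1 (Hu i2))) as Cs.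
fold s in C2u, Cs; rewrite E11, E21 in C1u; rewrite E22 in C2u.
assert (Cl1 := is_C1_dlog_1); assert (Cl2 := is_C1_dlog_2).
assert (Cq := is_C1_mult (is_C1_const (-1))
  (is_C1_plus (is_C1_mult Cl1 C1u) (is_C1_mult Cl2 C2u))).
fold q in Cq.
pose proof (is_C1_schwarz C1u Cq (is_C1_mult (is_C1_const (-1)) Cs)) as Sa.
pose proof (is_C1_schwarz C2u Cs Cq) as Sb.
apply (is_C1_ext (is_C1_plus
  (is_C1_mult (is_C1_const 2) Cs)
  (is_C1_mult (is_C1_const 2)
    (is_C1_plus (is_C1_mult Cl1 C2u)
       (is_C1_mult (is_C1_const (-1)) (is_C1_mult Cl2 C1u))))));
  intros x; pose proof (N x) as Nx.
- rewrite c_rot_conformal, E21 by exact Hk; fold s; ring.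
- specialize (Sa x); cbv beta in Sa.
  replace (pd i1 s x) with (- (0 * s x + -1 * pd i1 s x)) by ring.
  rewrite <- Sa; unfold conformal, q, dlog; unfold stereo_den in *; field; lra.
- rewrite (Sb x); unfold conformal, q, dlog; unfold stereo_den in *; field; lra.
Qed.

(** * Integration by parts in one chart *)

(** Lemmas on integrals leave equalities of reals at the carrier of a normed
    module, where [ring] and [field] do not recognize them. *)
Ltac real_eq := match goal with |- ?a = ?b => change (@eq R a b) end.

(** The outward flux of rot u * K v through the equator. There the conformal
    factor is 1 / kappa, and v^2 cos - e v^1 sin is the outward component of K v. *)
Definition boundary_flux kappa c (u v : components) : R :=
  RInt (fun phi =>
    let x := polar (handedness c) (1, phi) in
    c_rot (metric kappa c) u x / kappa
    * (v i2 x * cos phi - handedness c * v i1 x * sin phi)) 0 (2 * PI).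

Lemma continuous_c_rot kappa c v :
  0 < kappa -> (forall i, smooth (v i)) ->
  continuous_on_plane (c_rot (metric kappa c) v).
Proof.
intros Hk Hv.
replace (c_rot (metric kappa c) v) with (fun x =>
  pd i1 (v i2) x - pd i2 (v i1) x + 2 * (dlog i1 x * v i2 x - dlog i2 x * v i1 x)).
- pose proof (is_C1_continuous is_C1_dlog_1).
  pose proof (is_C1_continuous is_C1_dlog_2).
  pose proof (smooth_continuous (Hv i1)); pose proof (smooth_continuous (Hv i2)).
  pose proof (smooth_continuous (smooth_pd i1 (Hv i2))).
  pose proof (smooth_continuous (smooth_pd i2 (Hv i1))).
  plane_continuity.
- apply functional_extensionality; intros x; now rewrite c_rot_conformal.
Qed.

Lemma continuous_c_dot kappa c u v :
  0 < kappa -> (forall i, smooth (u i)) -> (forall i, smooth (v i)) ->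
  continuous_on_plane (c_dot (metric kappa c) u v).
Proof.
intros Hk Hu Hv.
replace (c_dot (metric kappa c) u v) with
  (fun x => conformal kappa x * (u i1 x * v i1 x + u i2 x * v i2 x)).
- pose proof (is_C1_continuous (is_C1_conformal kappa Hk)) as Cm.
  pose proof (smooth_continuous (Hu i1)); pose proof (smooth_continuous (Hu i2)).
  pose proof (smooth_continuous (Hv i1)); pose proof (smooth_continuous (Hv i2)).
  plane_continuity.
- apply functional_extensionality; intros x; now rewrite c_dot_conformal.
Qed.

Lemma stereo_den_equator e phi : e * e = 1 -> stereo_den (polar e (1, phi)) = 2.
Proof.
intros He; unfold stereo_den, polar; simpl.
pose proof (sin2_cos2 phi) as T; unfold Rsqr in T.
assert (T' : sin phi * sin phi = 1 - cos phi * cos phi) by lra.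
ring [He T'].
Qed.

(** The field with components conformal * rot u * K v is the density whose plane
    divergence is conformal times the Riemannian divergence of rot u * K v; by
    [killing_rot_gradient] the latter is rot u * rot v - 2 kappa g(u, v). *)
Lemma killing_flux kappa c u v :
  0 < kappa -> (forall i, smooth (u i)) -> (forall i, smooth (v i)) ->
  (forall k j x, c_S (metric kappa c) u k j x = 0) ->
  int_chart kappa c (fun x => c_rot (metric kappa c) u x * c_rot (metric kappa c) v x)
  = 2 * kappa * int_chart kappa c (c_dot (metric kappa c) v u)
    + boundary_flux kappa c u v.
Proof.
intros Hk Hu Hv HS.
pose proof (is_C1_conformal kappa Hk) as Cm.
pose proof (killing_rot_gradient kappa c u Hk Hu HS) as Ch.
assert (Cmh := is_C1_mult Cm Ch).
assert (CP := is_C1_mult Cmh (smooth_is_C1 (Hv i2))).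
assert (CQ := is_C1_mult (is_C1_const (-1)) (is_C1_mult Cmh (smooth_is_C1 (Hv i1)))).
pose proof (divergence_disk (handedness c) _ _ _ _ _ _ (handedness_sqr c) CP CQ) as D.
assert (E : boundary_flux kappa c u v = int_disk (handedness c) (fun x =>
   conformal kappa x * (c_rot (metric kappa c) u x * c_rot (metric kappa c) v x)
   - 2 * kappa * (conformal kappa x * c_dot (metric kappa c) v u x))).
{ eapply eq_trans; [|eapply eq_trans; [exact (eq_sym D)|]].
  - unfold boundary_flux; apply RInt_ext; intros phi _; cbv zeta.
    unfold conformal; rewrite stereo_den_equator by apply handedness_sqr.
    real_eq; field; lra.
  - apply f_equal, functional_extensionality; intros x.
    rewrite (c_rot_conformal kappa Hk c v), c_dot_conformal by exact Hk.
    ring. }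
rewrite E; unfold int_chart.
rewrite int_disk_linear.
- ring.
- pose proof (is_C1_continuous Cm).
  pose proof (is_C1_continuous Ch).
  pose proof (continuous_c_rot kappa c v Hk Hv).
  plane_continuity.
- pose proof (is_C1_continuous Cm).
  pose proof (continuous_c_dot kappa c v u Hk Hv Hu).
  plane_continuity.
Qed.

(** * The fluxes through the equator *)

Lemma dparamE kappa c i x :
  dparam kappa c i x =
  let r := radius kappa in
  let e := handedness c in
  let a := fst x in let b := snd x in
  let d := stereo_den x in
  match i with
  | i1 => mkR3 (r * (2 * d - 4 * a ^ 2) / d ^ 2) (- e * (4 * r * a * b) / d ^ 2)
            (- e * (4 * r * a) / d ^ 2)
  | i2 => mkR3 (- (4 * r * a * b) / d ^ 2) (e * r * (2 * d - 4 * b ^ 2) / d ^ 2)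
            (- e * (4 * r * b) / d ^ 2)
  end.
Proof.
pose proof (stereo_den_pos x) as Hd.
pose proof (fun y => Rgt_not_eq _ _ (stereo_den_pos y)) as N.
assert (I := is_C1_inv is_C1_stereo_den N).
assert (C1 := is_C1_mult (is_C1_mult (is_C1_const (2 * radius kappa)) is_C1_fst) I).
assert (C2 := is_C1_mult (is_C1_mult (is_C1_const (2 * radius kappa)) is_C1_snd) I).
assert (C2' := is_C1_mult (is_C1_const (handedness c)) C2).
assert (C3 := is_C1_mult (is_C1_const (handedness c * radius kappa))
 (is_C1_plus (is_C1_mult (is_C1_const 2) I) (is_C1_const (-1)))).
unfold dparam; cbv zeta.
replace (param kappa c) with (fun y : R2 =>
  mkR3 (2 * radius kappa * fst y * / stereo_den y)
       (handedness c * (2 * radius kappa * snd y * / stereo_den y))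
       (handedness c * radius kappa * (2 * / stereo_den y + -1))).
2: { apply functional_extensionality; intros y; pose proof (N y).
  destruct c; cbn -[radius pow stereo_den];
    change (1 + fst y ^ 2 + snd y ^ 2) with (stereo_den y);
    f_equal; real_eq; field; auto. }
cbn [X1 X2 X3].
destruct i;
  [ rewrite (proj1 (pd_is_C1 C1)), (proj1 (pd_is_C1 C2')), (proj1 (pd_is_C1 C3))
  | rewrite (proj2 (pd_is_C1 C1)), (proj2 (pd_is_C1 C2')), (proj2 (pd_is_C1 C3)) ];
  cbv beta; f_equal; field; lra.
Qed.

Lemma polar_equator e phi : polar e (1, phi) = (cos phi, e * sin phi).
Proof. unfold polar; simpl; now rewrite !Rmult_1_l. Qed.

(** The transition map is w = 1 / z, so a tangent vector n at z becomes - n / z^2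
    in the other chart, which is - n times the square of the conjugate of z on
    the equator. *)
Lemma comp_equator kappa w i phi :
  0 < kappa ->
  let n := fun k => comp kappa north w k (polar 1 (1, phi)) in
  comp kappa south w i (polar (-1) (1, phi)) =
  match i with
  | i1 => - ((cos phi ^ 2 - sin phi ^ 2) * n i1 + 2 * sin phi * cos phi * n i2)
  | i2 => 2 * sin phi * cos phi * n i1 - (cos phi ^ 2 - sin phi ^ 2) * n i2
  end.
Proof.
intros Hk n; unfold n, comp, sum.
rewrite !(ginv_conformal kappa Hk), !dparamE; unfold conformal; cbv zeta.
rewrite !stereo_den_equator by ring.
rewrite !polar_equator.
(* At the equator both parametrizations give the same point of the sphere. *)
replace (param kappa south (cos phi, -1 * sin phi))
  with (param kappa north (cos phi, 1 * sin phi)).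
2: { cbn -[radius pow]. pose proof (sin2_cos2 phi) as T; unfold Rsqr in T.
  replace (1 + cos phi ^ 2 + (1 * sin phi) ^ 2) with 2 by (ring_simplify; lra).
  replace (1 + cos phi ^ 2 + (-1 * sin phi) ^ 2) with 2 by (ring_simplify; lra).
  f_equal; field. }
destruct (w (param kappa north (cos phi, 1 * sin phi))) as [p q r].
pose proof (sin2_cos2 phi) as T; unfold Rsqr in T.
set (C := cos phi) in *; set (S := sin phi) in *; clearbody C S.
assert (T' : S * S = 1 - C * C) by lra.
destruct i; unfold dot3; cbn -[radius pow]; field_simplify_eq; try lra; ring [T'].
Qed.

(** The derivative of a Killing field along the equator determines its whole
    derivative there, by the Cauchy-Riemann equations. So it is enough to
    differentiate [comp_equator] in the longitude, and the derivatives of the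
    components need not be transported from one chart to the other. *)
Lemma rot_equator kappa u phi :
  0 < kappa -> vector_field kappa u -> killing kappa u ->
  c_rot (metric kappa south) (comp kappa south u) (polar (-1) (1, phi))
  = c_rot (metric kappa north) (comp kappa north u) (polar 1 (1, phi)).
Proof.
intros Hk [_ Hu] HS.
set (n := comp kappa north u) in *; set (s := comp kappa south u).
assert (Dn : forall k, is_derive (fun t : R => n k (polar 1 (1, t))) phi
    (pd i1 (n k) (polar 1 (1, phi)) * (- 1 * sin phi)
     + pd i2 (n k) (polar 1 (1, phi)) * (1 * (1 * cos phi)))).
{ intros k; apply is_derive_polar_angle; apply smooth_is_C1; apply (Hu north). }
assert (Ds : forall k, is_derive (fun t : R => s k (polar (-1) (1, t))) phi
    (pd i1 (s k) (polar (-1) (1, phi)) * (- 1 * sin phi)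
     + pd i2 (s k) (polar (-1) (1, phi)) * (-1 * (1 * cos phi)))).
{ intros k; apply is_derive_polar_angle; apply smooth_is_C1; apply (Hu south). }
assert (E := fun i t => comp_equator kappa u i t Hk); cbv zeta in E; fold n s in E.
assert (Es : forall k, is_derive (fun t : R => s k (polar (-1) (1, t))) phi
  (match k with
   | i1 => - (- 4 * sin phi * cos phi * n i1 (polar 1 (1, phi))
              + (cos phi ^ 2 - sin phi ^ 2)
                * Derive (fun t : R => n i1 (polar 1 (1, t))) phi
              + 2 * (cos phi ^ 2 - sin phi ^ 2) * n i2 (polar 1 (1, phi))
              + 2 * sin phi * cos phi * Derive (fun t : R => n i2 (polar 1 (1, t))) phi)
   | i2 => 2 * (cos phi ^ 2 - sin phi ^ 2) * n i1 (polar 1 (1, phi))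
           + 2 * sin phi * cos phi * Derive (fun t : R => n i1 (polar 1 (1, t))) phi
           - (- 4 * sin phi * cos phi * n i2 (polar 1 (1, phi))
              + (cos phi ^ 2 - sin phi ^ 2)
                * Derive (fun t : R => n i2 (polar 1 (1, t))) phi)
   end)).
{ assert (X : forall k, ex_derive (fun t : R => n k (polar 1 (1, t))) phi)
    by (intros k; eexists; apply Dn).
  pose proof (X i1) as X1; pose proof (X i2) as X2; clear X.
  set (m1 := fun t : R => n i1 (polar 1 (1, t))) in *.
  set (m2 := fun t : R => n i2 (polar 1 (1, t))) in *.
  intros k; apply (is_derive_ext (fun t : R => match k with
   | i1 => - ((cos t ^ 2 - sin t ^ 2) * m1 t + 2 * sin t * cos t * m2 t)
   | i2 => 2 * sin t * cos t * m1 t - (cos t ^ 2 - sin t ^ 2) * m2 t end)).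
  - intros t; symmetry; apply E.
  - change (n i1 (polar 1 (1, phi))) with (m1 phi);
    change (n i2 (polar 1 (1, phi))) with (m2 phi).
    clearbody m1 m2.
    change (Derive m1 phi) with (Derive (fun t : R => m1 t) phi).
    change (Derive m2 phi) with (Derive (fun t : R => m2 t) phi).
    destruct k; (auto_derive; [repeat split; assumption | ring]). }
assert (B : forall k, _ = _) by
  (intros k; exact (eq_trans (eq_sym (is_derive_unique _ _ _ (Ds k)))
                             (is_derive_unique _ _ _ (Es k)))).
pose proof (B i1) as B1; pose proof (B i2) as B2; clear B.
cbv beta iota in B1, B2.
assert (A : forall k, _ = _) by (intros k; exact (is_derive_unique _ _ _ (Dn k))).
rewrite !A in B1, B2.
destruct (killing_cauchy_riemann kappa Hk north n (polar 1 (1, phi)))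
  as (Na & Nb & Nc);
  [intros; apply HS|].
destruct (killing_cauchy_riemann kappa Hk south s (polar (-1) (1, phi)))
  as (Sa & Sb & Sc);
  [intros; apply HS|].
rewrite !c_rot_conformal by exact Hk.
rewrite Na, Nb, Nc in B1, B2; rewrite Sa, Sc in B1; rewrite Sb in B2; rewrite Nc, Sc.
unfold dlog in *; rewrite !stereo_den_equator in * by ring.
rewrite !(E i1 phi), !(E i2 phi) in *.
rewrite !polar_equator in *; cbn [fst snd] in *.
pose proof (sin2_cos2 phi) as T; unfold Rsqr in T.
set (p := pd i1 (n i2) _) in *; set (q := pd i1 (s i2) _) in *.
set (n1 := n i1 _) in *; set (n2 := n i2 _) in *.
set (C := cos phi) in *; set (S := sin phi) in *.
clearbody p q n1 n2 C S.
assert (T' : S * S = 1 - C * C) by lra.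
(* In cos * B1 - sin * B2 the coefficient of q, the only derivative left from the
   south chart, is cos^2 + sin^2. *)
match type of B1 with ?l1 = ?r1 => match type of B2 with ?l2 = ?r2 =>
  assert (W : C * (l1 - r1) - S * (l2 - r2) = 0) by (rewrite B1, B2; ring) end end.
match goal with |- ?l = ?r => match type of W with ?w = 0 =>
  cut (l - r = 2 * w); [rewrite W; lra|] end end.
field_simplify_eq; ring [T'].
Qed.

(** The outward normal of one hemisphere is the inward normal of the other. *)
Lemma boundary_flux_cancel kappa u v :
  0 < kappa -> vector_field kappa u -> killing kappa u -> vector_field kappa v ->
  boundary_flux kappa north (comp kappa north u) (comp kappa north v)
  + boundary_flux kappa south (comp kappa south u) (comp kappa south v) = 0.
Proof.
intros Hk Hu HS Hv.
replace (boundary_flux kappa south _ _) with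
  (- boundary_flux kappa north (comp kappa north u) (comp kappa north v)); [ring|].
unfold boundary_flux; cbv zeta; simpl handedness.
rewrite <- (RInt_opp (V := R_CompleteNormedModule)).
- apply RInt_ext; intros phi _.
  rewrite rot_equator by assumption.
  rewrite !(comp_equator kappa v) by exact Hk.
  pose proof (sin2_cos2 phi) as T; unfold Rsqr in T.
  assert (T' : sin phi * sin phi = 1 - cos phi * cos phi) by lra.
  unfold opp; simpl. field_simplify_eq; [ring [T'] | lra].
- assert (Cc : forall F, continuous_on_plane F ->
    forall t, continuous (fun t => F (polar 1 (1, t))) t).
  { intros F HF; apply (continuous_slice (fun q => F (polar 1 q)) 1).
    now apply continuous_polar. }
  assert (Cv : forall i, continuous_on_plane (comp kappa north v i))
    by (intros i; apply (is_C1_continuous (smooth_is_C1 (proj2 Hv north i)))).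
  apply ex_RInt_continuous_all; intros t.
  apply continuous_Rmult; [apply continuous_Rmult; [|apply continuous_Rconst]|].
  + apply (Cc (c_rot (metric kappa north) (comp kappa north u))), continuous_c_rot; auto.
    intros i; apply (proj2 Hu north).
  + apply continuous_Rminus; apply continuous_Rmult.
    * apply (Cc _ (Cv i2)).
    * apply continuous_cos.
    * apply continuous_Rmult; [apply continuous_Rconst | apply (Cc _ (Cv i1))].
    * apply continuous_sin.
Qed.

(** * Orthogonality of the vorticities *)

Theorem inner_rot_killing kappa u v :
  0 < kappa -> vector_field kappa u -> vector_field kappa v -> killing kappa u ->
  inner_fun kappa (rot kappa u) (rot kappa v) = 2 * kappa * inner_field kappa v u.
Proof.
intros Hk Hu Hv HS.
assert (Cr : forall w, vector_field kappa w -> forall c,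
  continuous_on_plane (c_rot (metric kappa c) (comp kappa c w)))
  by (intros w Hw c; apply continuous_c_rot; auto; apply (proj2 Hw)).
unfold inner_fun, inner_field, gdot.
replace (fun X => rot kappa u X * rot kappa v X) with
  (glue kappa (fun c x => c_rot (metric kappa c) (comp kappa c u) x
                          * c_rot (metric kappa c) (comp kappa c v) x))
  by (apply functional_extensionality; intros X;
      unfold rot, glue; destruct Rle_dec; reflexivity).
rewrite !integral_glue; auto.
- rewrite !killing_flux by (auto; apply Hu || apply Hv || apply HS).
  pose proof (boundary_flux_cancel kappa u v Hk Hu HS Hv). lra.
- intros c; apply continuous_c_dot; auto; [apply Hv | apply Hu].
- intros c x; apply continuous_Rmult; now apply Cr.
Qed.

Lemma rot_add kappa w u v :
  0 < kappa -> vector_field kappa u -> vector_field kappa v ->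
  (forall X, on_sphere kappa X -> w X = add3 (u X) (v X)) ->
  forall X, rot kappa w X = rot kappa u X + rot kappa v X.
Proof.
intros Hk [_ Hu] [_ Hv] Hw.
assert (E : forall c i,
  comp kappa c w i = fun x => comp kappa c u i x + comp kappa c v i x).
{ intros c i; apply functional_extensionality; intros x; unfold comp, sum.
  rewrite Hw by apply param_on_sphere.
  unfold dot3, add3; simpl X1; simpl X2; simpl X3; ring. }
assert (H : forall c x, c_rot (metric kappa c) (comp kappa c w) x =
  c_rot (metric kappa c) (comp kappa c u) x + c_rot (metric kappa c) (comp kappa c v) x).
{ intros c x; rewrite !c_rot_conformal, !E by exact Hk.
  assert (P := fun i => pd_is_C1
    (is_C1_plus (smooth_is_C1 (Hu c i)) (smooth_is_C1 (Hv c i)))).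
  rewrite (proj1 (P i2)), (proj2 (P i1)).
  ring. }
intros X; unfold rot, glue; destruct Rle_dec; apply H.
Qed.

Theorem lemma7p1 (kappa mu : R) (I : R -> Prop) (u : R -> sfield)
    (p : R -> sfun) (t : R) (uK uP : sfield)
    (Hkappa : 0 < kappa)
    (HI : open I) (Ht : I t)
    (Hu : time_vector_field kappa I u)
    (Hp : time_function kappa I p)
    (HNS : navier_stokes kappa mu I u p)
    (HuK : vector_field kappa uK)
    (HuP : vector_field kappa uP)
    (Hdec : forall X, on_sphere kappa X -> u t X = add3 (uK X) (uP X))
    (HK : killing kappa uK)
    (HP : forall v, vector_field kappa v -> killing kappa v ->
          inner_field kappa uP v = 0) :
  (forall X, on_sphere kappa X ->
     rot kappa (u t) X = rot kappa uK X + rot kappa uP X) /\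
  inner_fun kappa (rot kappa uK) (rot kappa uP) = 0.
Proof.
split.
- intros X _; now apply rot_add.
- rewrite inner_rot_killing, HP by assumption; ring.
Qed.
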